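(* Let $\boldsymbol{Y}^{(1)},\dots,\boldsymbol{Y}^{(N)}$ be multi-object trajectories, $L=\sum_{n=1}^N|\boldsymbol{Y}^{(n)}|$, and let $\xi^{(1)},\dots,\xi^{(N)}\in\mathbb{B}^L$ and $\chi^{(1)},\dots,\chi^{(N)}\in\mathbb{T}^L$ denote their respective existence lists and trajectory lists, where $\mathbb{B}=\{0,1\}$. Define the functions $$Q_\omega^{(r)}(\eta,\tau)=\sum_{\ell=1}^L\Big(\eta_\ell\,\phi_{\omega,\ell}^{(r)}(\eta,\tau_\ell)+(1-\eta_\ell)\,\bar\phi_{\omega,\ell}^{(r)}(\eta)\Big),$$ $$\phi_{\omega,\ell}^{(r)}(\eta,\tau_\ell)=\sum_{n=1}^N\frac{\xi^{(n)}_{\omega(n,\ell)}[d_{\mathbb{T}}^{(c)}(\tau_\ell,\chi^{(n)}_{\omega(n,\ell)})]^r+(1-\xi^{(n)}_{\omega(n,\ell)})\,p^r}{\kappa(\|\eta\|_1,\|\xi^{(n)}\|_1)},$$ $$\bar\phi_{\omega,\ell}^{(r)}(\eta)=\sum_{n=1}^N\frac{\xi^{(n)}_{\omega(n,\ell)}\,p^r}{\kappa(\|\eta\|_1,\|\xi^{(n)}\|_1)}.$$ If $$(\hat\eta,\hat\tau)=\arg\min_{(\eta,\tau)\in\mathbb{B}^L\times\mathbb{T}^L}\ \min_{\omega\in\Omega^{(1:N)}(\eta)}Q_\omega^{(r)}(\eta,\tau),$$ then the multi-object trajectory $\hat{\boldsymbol{X}}=\{\hat\tau_\ell:\hat\eta_\ell=1\}$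 is an $r$-th order Fréchet mean of $\boldsymbol{Y}^{(1)},\dots,\boldsymbol{Y}^{(N)}$ with respect to the OSPA-based metric $\boldsymbol{d}$ described in the context.
   Context: Let $\mathbb{T}$ be the space of trajectories: a trajectory is a function from time instances in a finite time window $\mathbb{K}$ to a state space $\mathbb{X}$, defined on a subset of $\mathbb{K}$ (its domain). A multi-object trajectory is a (finite) multi-set of elements of $\mathbb{T}$; $\mathcal{M}(\mathbb{T})$ is the space of all of them, and $|\boldsymbol{X}|$ is the cardinality counted with multiplicity. Let $r$ be a positive integer, $p\ge0$, $c\in[p,\sqrt[r]{2}\,p]$, let $d_{\mathbb{T}}$ be a trajectory distance on $\mathbb{T}$, and $d_{\mathbb{T}}^{(c)}(y,z)=\min\{d_{\mathbb{T}}(y,z),c\}$. Let $\kappa$ be a non-negative real function of pairs of non-negative integers with $\kappa(s,m)=\kappa(m,s)$. For $\boldsymbol{X}=\{\boldsymbol{X}_1,\dots,\boldsymbol{X}_m\}$ and $\boldsymbol{Y}=\{\boldsymbol{Y}_1,\dots,\boldsymbol{Y}_s\}$ with $m\le s$, $$\boldsymbol{d}(\boldsymbol{X},\boldsymbol{Y})=\left[\min_{\pi\in\Pi_s}\frac{\sum_{\ell=1}^m[d_{\mathbb{T}}^{(c)}(\boldsymbol{X}_\ell,\boldsymbol{Y}_{\pi(\ell)})]^r+|s-m|\,p^r}{\kappa(s,m)}\right]^{1/r},$$ where $\Pi_s$ is the set of permutations of $\{1,\dots,s\}$; $\boldsymbol{d}(\emptyset,\emptyset)=0$; and $\boldsymbol{d}(\boldsymbol{X},\boldsymbol{Y})=\boldsymbol{d}(\boldsymbol{Y},\boldsymbol{X})$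 if $m>s$. An $r$-th order Fréchet mean of $\boldsymbol{Y}^{(1)},\dots,\boldsymbol{Y}^{(N)}$ is a minimizer over $\boldsymbol{X}\in\mathcal{M}(\mathbb{T})$ of $\sum_{n=1}^N\boldsymbol{d}^r(\boldsymbol{X},\boldsymbol{Y}^{(n)})$ (not necessarily unique). Existence and trajectory lists: a multi-object trajectory $\{\boldsymbol{X}_1,\dots,\boldsymbol{X}_m\}$ with $m\le L$ has existence list $\eta\in\mathbb{B}^L$ and trajectory list $\tau\in\mathbb{T}^L$ given by $\eta_\ell=1$, $\tau_\ell=\boldsymbol{X}_\ell$ for $\ell=1,\dots,m$, and $\eta_\ell=0$, $\tau_\ell=\boldsymbol{0}$ (the function mapping every element of $\mathbb{K}$ to zero) otherwise. Existence assignments: for $\eta\in\mathbb{B}^L$, $\Omega^{(n)}(\eta)$ is the set of permutations $\pi$ of $\{1,\dots,L\}$ such that $\eta_\ell=1\Rightarrow\xi^{(n)}_{\pi(\ell)}=1$ if $\|\eta\|_1\le\|\xi^{(n)}\|_1$, or $\xi^{(n)}_{\pi(\ell)}=1\Rightarrow\eta_\ell=1$ if $\|\eta\|_1>\|\xi^{(n)}\|_1$. $\Omega^{(1:N)}(\eta)=\Omega^{(1)}(\eta)\times\dots\times\Omega^{(N)}(\eta)$, and $\omega=(\omega^{(1)},\dots,\omega^{(N)})\in\Omega^{(1:N)}(\eta)$ is viewed as an $N\times L$ matrix with entries $\omega(n,\ell)=\omega^{(n)}(\ell)$.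
   Formalization: Added hypothesis: (s−m)/κ(s,m) ≤ (t−m)/κ(t,m) for all m ≤ s ≤ t (true for κ constant and κ = max); for arbitrary non-negative symmetric κ the claim is false, since multi-object trajectories with more than L elements can have smaller cost. *)

(* Defs.v *)
From HB Require Import structures.
From mathcomp Require Import all_boot all_order all_fingroup all_algebra.
From mathcomp Require Import finmap multiset.
From mathcomp Require Import reals exp.
Set Implicit Arguments.
Unset Strict Implicit.
Unset Printing Implicit Defensive.

Import Order.TTheory GRing.Theory Num.Theory.
Local Open Scope mset_scope.
Local Open Scope ring_scope.

(* The minimum of F over A; the junk value 0 is only returned when A is empty. *)
Definition fmin (R : realDomainType) (I : finType) (A : {set I}) (F : I -> R) : R :=
  if [pick i in A] is Some i0 then \big[Order.min/F i0]_(i in A) F i else 0.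

(* A trajectory is a partial function on the time window K: the domain of f is
   the set of k such that f k != None. *)
Definition trajectory (K : finType) (X : zmodType) : choiceType :=
  {ffun K -> option X}.

Definition zero_trajectory (K : finType) (X : zmodType) : trajectory K X :=
  [ffun=> Some 0].

Record is_distance (R : numDomainType) (T : Type) (d : T -> T -> R) : Prop :=
  IsDistance {
    distance_ge0 : forall x y, 0 <= d x y;
    distance_eq0 : forall x y, d x y = 0 <-> x = y;
    distance_sym : forall x y, d x y = d y x;
    distance_triangle : forall x y z, d x z <= d x y + d y z }.

Definition cutoff (R : realDomainType) (T : Type) (d : T -> T -> R) (c : R)
  (x y : T) : R := Num.min (d x y) c.

(* kappa only has to be nonnegative; a quotient by kappa s m = 0 (for instance
   kappa = max at (0, 0)) is 0, as is every division by 0 in a field here. *)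
Definition is_normalizer (R : numDomainType) (kappa : nat -> nat -> R) : Prop :=
  (forall s m, 0 <= kappa s m) /\ (forall s m, kappa s m = kappa m s).

(* For a fixed cardinality m, the cost (up to the factor p ^+ r) of s - m
   unmatched objects does not decrease with s.  This holds for constant kappa
   and for kappa = max.  Without it, adding elements to a multi-object trajectory
   can keep lowering its cost, so that no bound on the number of elements of a
   Frechet mean holds. *)
Definition monotone_cardinality_penalty (R : numFieldType)
    (kappa : nat -> nat -> R) : Prop :=
  forall m s t : nat, (m <= s)%N -> (s <= t)%N ->
    (s - m)%:R / kappa s m <= (t - m)%:R / kappa t m.

Section MultiObject.
Variables (R : realType) (K : finType) (X : zmodType).
Local Notation T := (trajectory K X).
Local Notation zeroT := (zero_trajectory K X).
Variables (dT : T -> T -> R) (p c : R) (r : nat) (kappa : nat -> nat -> R).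

(* Meant for size x <= size y. *)
Definition ospa_seq (x y : seq T) : R :=
  let m := size x in let s := size y in
  fmin [set: 'S_s] (fun pi : 'S_s =>
    (\sum_(l < s | (l < m)%N)
        cutoff dT c (nth zeroT x l) (nth zeroT y (pi l)) ^+ r
     + (s - m)%:R * p ^+ r) / kappa s m) `^ r%:R^-1.

(* x and y are coerced to their enumerations with multiplicity; the order in
   which the elements are listed is immaterial. *)
Definition ospa (x y : {mset T}) : R :=
  if (size x == 0)%N && (size y == 0)%N then 0
  else if (size x <= size y)%N then ospa_seq x y else ospa_seq y x.

Definition frechet_mean (N : nat) (Y : 'I_N -> {mset T}) (x : {mset T}) : Prop :=
  forall z : {mset T},
    \sum_(n < N) ospa x (Y n) ^+ r <= \sum_(n < N) ospa z (Y n) ^+ r.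

Definition existence_list (L : nat) (s : seq T) : {ffun 'I_L -> bool} :=
  [ffun l : 'I_L => (l < size s)%N].

Definition trajectory_list (L : nat) (s : seq T) : {ffun 'I_L -> T} :=
  [ffun l : 'I_L => if (l < size s)%N then nth zeroT s l else zeroT].

Definition of_lists (L : nat) (eta : {ffun 'I_L -> bool}) (tau : {ffun 'I_L -> T})
  : {mset T} := seq_mset [seq tau l | l <- enum 'I_L & eta l].

Definition norm1 (L : nat) (eta : {ffun 'I_L -> bool}) : nat :=
  (\sum_(l < L) eta l)%N.

Definition assignments (L : nat) (eta xi : {ffun 'I_L -> bool}) : {set 'S_L} :=
  [set pi : 'S_L | if (norm1 eta <= norm1 xi)%N
            then [forall l, eta l ==> xi (pi l)]
            else [forall l, xi (pi l) ==> eta l]].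

Section Lists.
Variables (N L : nat) (xi : 'I_N -> {ffun 'I_L -> bool})
  (chi : 'I_N -> {ffun 'I_L -> T}).

Definition all_assignments (eta : {ffun 'I_L -> bool})
  : {set {ffun 'I_N -> 'S_L}} :=
  [set omega : {ffun 'I_N -> 'S_L} | [forall n, omega n \in assignments eta (xi n)]].

Definition phi (omega : {ffun 'I_N -> 'S_L}) (l : 'I_L)
    (eta : {ffun 'I_L -> bool}) (t : T) : R :=
  \sum_(n < N)
    ((xi n (omega n l))%:R * cutoff dT c t (chi n (omega n l)) ^+ r
     + (1 - (xi n (omega n l))%:R) * p ^+ r) / kappa (norm1 eta) (norm1 (xi n)).

Definition phibar (omega : {ffun 'I_N -> 'S_L}) (l : 'I_L)
    (eta : {ffun 'I_L -> bool}) : R :=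
  \sum_(n < N)
    ((xi n (omega n l))%:R * p ^+ r) / kappa (norm1 eta) (norm1 (xi n)).

Definition Qcost (omega : {ffun 'I_N -> 'S_L}) (eta : {ffun 'I_L -> bool})
    (tau : {ffun 'I_L -> T}) : R :=
  \sum_(l < L) ((eta l)%:R * phi omega l eta (tau l)
                + (1 - (eta l)%:R) * phibar omega l eta).

Definition min_Qcost (eta : {ffun 'I_L -> bool}) (tau : {ffun 'I_L -> T}) : R :=
  fmin (all_assignments eta) (fun omega => Qcost omega eta tau).
End Lists.
End MultiObject.

(* Main.v *)
(* Fill both multi-object trajectories up to L slots with empty slots; the OSPA
   cost becomes the cheapest sum of slot costs (cut-off distance between two
   occupied slots, p^r between an occupied and an empty one) over the bijections
   of slots that match as many objects as possible, i.e. the existence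
   assignments.  Q_omega splits over n into such sums, so the minimum of Q_omega
   over omega is exactly the Frechet cost of the multi-object trajectory encoded
   by (eta, tau), and the hypothesis says that the candidate is optimal among
   those with at most L elements.  An x with more than L elements pays at least
   the penalties of its unmatched elements, hence, by monotonicity of the
   penalty, at least as much as the union of all the Y^(n), which has L elements
   and pays nothing else. *)
Require Import Defs.
From mathcomp Require Import all_boot all_order all_fingroup all_algebra.
From mathcomp Require Import finmap multiset.
From mathcomp Require Import reals exp.
Set Implicit Arguments.
Unset Strict Implicit.
Unset Printing Implicit Defensive.
Import Order.TTheory GRing.Theory Num.Theory.
Local Open Scope mset_scope.
Local Open Scope ring_scope.

(** * Finite minima, and sequences of possibly empty slots *)

Lemma fmin_le (R : realDomainType) (I : finType) (A : {set I}) (F : I -> R) i :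
  i \in A -> fmin A F <= F i.
Proof.
rewrite /fmin; case: pickP => [i0 _ iA | A0]; last by rewrite A0.
by rewrite (bigminD1 i) // ge_min lexx.
Qed.

(** The fold starts at [F i0] with [i0] in [A], and a binary minimum returns one of its arguments,
    so it never leaves the values of [F] on [A]. *)
Lemma fmin_attained (R : realDomainType) (I : finType) (A : {set I})
    (F : I -> R) i :
  i \in A -> exists2 j, j \in A & fmin A F = F j.
Proof.
rewrite /fmin; case: pickP => [i0 i0A _ | A0]; last by rewrite A0.
by elim/big_ind: _ => [|u v [j jA ->] [k kA ->] | j jA]; [exists i0 | | exists j];
  rewrite // minEle; case: ifP => _; [exists j | exists k].
Qed.

(** The multiplicity of [Some v] can be read off [pmap id]; that of [None] is what remains of the
    total size. *)
Lemma perm_eq_option (T : eqType) (s t : seq (option T)) :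
  size s = size t -> perm_eq (pmap id s) (pmap id t) -> perm_eq s t.
Proof.
have count_pmap (u : seq (option T)) v :
    count_mem (Some v) u = count_mem v (pmap id u).
  by elim: u => //= -[w|] u /= ->.
move=> eq_size /seq.permP eq_pmap; apply/allP => -[v _|_] /=.
  by rewrite !count_pmap eq_pmap.
have countN (u : seq (option T)) : (count_mem None u + size (pmap id u))%N = size u.
  by elim: u => //= -[w|] u /= <-; rewrite ?addnS.
have := countN s; rewrite eq_size -(countN t).
by rewrite -!count_predT eq_pmap => /addIn ->.
Qed.

Lemma perm_eq_codom (T : eqType) L (f g : 'I_L -> T) :
  perm_eq (codom f) (codom g) -> exists sigma : 'S_L, forall l, f l = g (sigma l).
Proof.
have -> : codom g = [tuple g i | i < L] by rewrite codomE.
case/tuple_permP=> sigma; rewrite codomE /= => /eq_in_map fE.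
by exists sigma => l; rewrite fE ?mem_enum // tnth_map tnth_ord_tuple.
Qed.

Lemma pmap_id_map (I T : Type) (f : I -> option T) s :
  pmap id (map f s) = pmap f s.
Proof. by elim: s => //= i s ->. Qed.

(** [onth x] is [None] past the end of [x], so it serves as the padding of [x] with empty slots. *)
Lemma pmap_onth (T : Type) (x : seq T) L :
  (size x <= L)%N -> pmap (fun l : 'I_L => onth x l) (enum 'I_L) = x.
Proof.
move=> x_le; rewrite -(pmap_id_map (fun l : 'I_L => onth x l)).
rewrite (map_comp (onth x) val) val_enum_ord pmap_id_map -(subnKC x_le) iotaD.
rewrite pmap_cat [X in _ ++ X](_ : _ = [::]) ?cats0; last first.
  apply: size0nil; rewrite size_pmap; apply/eqP; rewrite -leqn0 leqNgt -has_count.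
  apply/hasPn => i; rewrite mem_iota add0n => /andP[x_le_i _].
  by rewrite onthE nth_default // size_map.
elim: x {x_le} => //= a x IH; congr cons; rewrite -[RHS]IH.
by rewrite -[1%N]addn0 iotaDl -[LHS]pmap_id_map -map_comp pmap_id_map.
Qed.

(** * Costs of lists matched by position, and costs of slots *)

Section Matching.
Variables (R : numDomainType) (T : eqType) (D : T -> T -> R) (q : R).
Hypothesis symD : forall a b, D a b = D b a.

Definition slot_cost (a b : option T) : R :=
  match a, b with
  | Some a, Some b => D a b
  | None, None => 0
  | _, _ => q
  end.

Definition matching_cost (x y : seq T) : R :=
  (* truncated subtractions: their sum is the absolute difference of sizes *)
  \sum_(ab <- zip x y) D ab.1 ab.2
  + ((size x - size y) + (size y - size x))%:R * q.

Lemma slot_costC a b : slot_cost a b = slot_cost b a.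
Proof. by case: a b => [a|] [b|] //=. Qed.

Lemma matching_costC x y : matching_cost x y = matching_cost y x.
Proof.
rewrite /matching_cost addnC; congr (_ + _).
by elim: x y => [|a x IH] [|b y] //=; rewrite ?big_nil // !big_cons IH symD.
Qed.

Lemma matching_cost_nil y : matching_cost [::] y = (size y)%:R * q.
Proof. by case: y => [|b y]; rewrite /matching_cost /= big_nil add0r. Qed.

Lemma matching_cost_cons a x b y :
  matching_cost (a :: x) (b :: y) = D a b + matching_cost x y.
Proof. by rewrite /matching_cost /= big_cons !subSS addrA. Qed.

(** Appended at the end of the longer list, [b] stays unmatched and shifts no existing pair. *)
Lemma matching_cost_rcons x y b : (size x <= size y)%N ->
  matching_cost x (rcons y b) = q + matching_cost x y.
Proof.
elim: x y => [|a x IH] [|c y] //= xy.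
- by rewrite !matching_cost_nil mul1r mul0r addr0.
- by rewrite !matching_cost_nil /= size_rcons -natr1 mulrDl mul1r addrC.
- by rewrite !matching_cost_cons IH // addrCA.
Qed.

Lemma sum_slot_cost x y L : (size x <= L)%N -> (size y <= L)%N ->
  \sum_(l < L) slot_cost (onth x l) (onth y l) = matching_cost x y.
Proof.
have nil_case z M : (size z <= M)%N ->
    \sum_(l < M) slot_cost None (onth z l) = matching_cost [::] z.
  elim: z M => [|a z IH] [|M] //= zM; rewrite matching_cost_nil.
  - by rewrite big_ord0 mul0r.
  - by rewrite big1 ?mul0r // => l _; case: (nat_of_ord l).
  rewrite big_ord_recl /= -natr1 mulrDl mul1r addrC.
  by congr (_ + _); rewrite -matching_cost_nil -(IH M).
elim: x y L => [|a x IH] y L xL yL.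
  by rewrite -(nil_case y L) //; apply: eq_bigr => l _; case: (nat_of_ord l).
case: y yL => [|b y] yL.
  rewrite matching_costC -(nil_case (a :: x) L) //; apply: eq_bigr => l _.
  by rewrite slot_costC; case: (nat_of_ord l).
case: L xL yL => // L xL yL.
by rewrite big_ord_recl /= matching_cost_cons -(IH _ L).
Qed.

Definition filled_le (ab : option T * option T) := isSome ab.1 ==> isSome ab.2.

(** Doubly occupied slots are put at the front of both lists, and a slot occupied only on the right
    goes to the end of [y]. This reorders the objects, hence the conclusion up to [perm_eq]. *)
Lemma slots_matching_le (P : seq (option T * option T)) : all filled_le P ->
  exists x y, [/\ (size x <= size y)%N,
    perm_eq x (pmap fst P), perm_eq y (pmap snd P) &
    \sum_(ab <- P) slot_cost ab.1 ab.2 = matching_cost x y].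
Proof.
elim: P => [_|[[a|] [b|]] P IH] //=.
- exists [::], [::]; split=> //.
  by rewrite big_nil matching_cost_nil mul0r.
- case/IH=> x [y [xy px py E]]; exists (a :: x), (b :: y).
  by split; rewrite /= ?perm_cons // big_cons E matching_cost_cons.
- case/IH=> x [y [xy px py E]]; exists x, (rcons y b).
  rewrite size_rcons leqW // big_cons E matching_cost_rcons //; split=> //.
  by rewrite perm_rcons perm_cons.
- case/IH=> x [y [xy px py E]]; exists x, y.
  by split=> //; rewrite big_cons E add0r.
Qed.

(** The inclusion of occupied slots is essential: one slot occupied only in [a] and another only in
    [b] would cost [q] twice, whereas the lists would match their two objects. *)
Lemma slots_matching L (a b : 'I_L -> option T) :
  (forall l, a l -> b l) \/ (forall l, b l -> a l) ->
  exists x y, [/\ perm_eq x (pmap a (enum 'I_L)), perm_eq y (pmap b (enum 'I_L)) &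
    \sum_(l < L) slot_cost (a l) (b l) = matching_cost x y].
Proof.
wlog ab: a b / forall l, a l -> b l.
  move=> W; case=> [ab | ba]; first by apply: W => //; left.
  have [|y [x [py px E]]] := W b a ba; first by left.
  exists x, y; split; rewrite // matching_costC -E.
  by apply: eq_bigr => l _; rewrite slot_costC.
move=> _; have [|x [y [_ px py E]]] := @slots_matching_le [seq (a l, b l) | l <- enum 'I_L].
  by apply/allP => _ /mapP[l _ ->]; apply/implyP; exact: ab.
exists x, y; split; last by rewrite -E big_map big_enum.
- by rewrite (perm_trans px) // -pmap_id_map -map_comp pmap_id_map.
- by rewrite (perm_trans py) // -pmap_id_map -map_comp pmap_id_map.
Qed.

(** Converse passage, from lists to slots: [a] and [b] are rearrangements of the paddings of [x] and
    [y], and the paddings are matched by position. The two implications serve the two branches of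
    [assignments]. *)
Lemma exists_slot_perm L (a b : 'I_L -> option T) x y :
  perm_eq x (pmap a (enum 'I_L)) -> perm_eq y (pmap b (enum 'I_L)) ->
  exists2 omega : 'S_L,
    ((size x <= size y)%N -> forall l, a l -> b (omega l)) /\
    ((size y <= size x)%N -> forall l, b (omega l) -> a l) &
    \sum_(l < L) slot_cost (a l) (b (omega l)) = matching_cost x y.
Proof.
have pad (c : 'I_L -> option T) z : perm_eq z (pmap c (enum 'I_L)) ->
    (size z <= L)%N /\ exists sigma : 'S_L, forall l, c (sigma l) = onth z l.
  move=> pz; have zL : (size z <= L)%N.
    by rewrite (perm_size pz) size_pmap (leq_trans (count_size _ _)) // size_enum_ord.
  split=> //; suff /perm_eq_codom[s sE] :
    perm_eq (codom (fun l : 'I_L => onth z l)) (codom c) by exists s => l; rewrite sE.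
  by apply: perm_eq_option; rewrite !codomE ?size_map // !pmap_id_map pmap_onth.
move=> /pad[xL [s sE]] /pad[yL [t tE]].
have onth_some (z : seq T) i : isSome (onth z i) = (i < size z)%N.
  rewrite onthE; case: ltnP => [iz | zi]; last by rewrite nth_default ?size_map.
  by elim: z i iz => [|v z IH] [|i] //=; apply: IH.
have omegaE l : ((s^-1 * t)%g l = t ((s^-1)%g l)) by rewrite permM.
(* From a slot of [a] to its position in [x], then from the same position in [y] to its slot of [b];
   the left factor acts first. *)
exists (s^-1 * t)%g.
  have aE l : a l = onth x ((s^-1)%g l) by rewrite -sE permKV.
  by split=> xy l; rewrite omegaE tE aE !onth_some => /leq_trans; apply.
rewrite (reindex_inj (@perm_inj _ s)) -(sum_slot_cost xL yL); apply: eq_bigr => l _.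
by rewrite omegaE permK sE tE.
Qed.

(** The OSPA formula permutes only the longer list; a reordering of the shorter one is therefore
    transferred to the longer one. *)
Lemma matching_cost_perm (x' x y' : seq T) : perm_eq x' x -> (size x <= size y')%N ->
  exists2 y, perm_eq y y' & matching_cost x y = matching_cost x' y'.
Proof.
move=> pxx xy; have sx := perm_size pxx.
(* A nonempty [x'] supplies the default element for [nth] and [perm_iotaP]. *)
case: x' => [|a0 x0] in pxx sx *.
  by move: pxx; rewrite perm_sym => /perm_nilP ->; exists y'.
set x' := a0 :: x0 in pxx sx *.
have st : size x' = size (take (size x') y') by rewrite size_take_min sx (minn_idPl _).
move: pxx; rewrite perm_sym => /(perm_iotaP a0)[Is pIs ->].
(* The matched part of [y'] is rearranged by the indices [Is] that turn [x'] into [x]; the unmatched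
   tail is left alone. The zipped pairs are then merely permuted. *)
exists ([seq nth a0 (take (size x') y') i | i <- Is] ++ drop (size x') y').
  rewrite -[X in perm_eq _ X](cat_take_drop (size x')) perm_cat2r.
  by apply/(perm_iotaP a0); exists Is; rewrite -?st.
have sI : size Is = size x' by rewrite (perm_size pIs) size_iota.
rewrite /matching_cost size_cat !size_map size_drop sI subnKC ?sx // -sx.
congr (_ + _).
rewrite -[map _ Is]cats0 zip_cat ?size_map //.
have -> : zip x' y' = zip x' (take (size x') y').
  elim: {+}x' {+}y' => [|a u IH] [|b v] //=; by rewrite -IH.
have -> : zip [::] (drop (size x') y') = [::] by case: drop.
rewrite cats0 zip_map big_map.
under eq_bigr => i _ do rewrite -(nth_zip a0 a0) //.
rewrite -(big_map (nth (a0,a0) (zip x' (take (size x') y'))) xpredT (fun ab => D ab.1 ab.2)).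
apply: perm_big; apply/(perm_iotaP (a0,a0)); exists Is => //.
by rewrite size_zip -st minnn.
Qed.
End Matching.

(** * The OSPA distance as a least matching cost *)

Section Ospa.
Variables (R : realType) (K : finType) (X : zmodType).
Local Notation T := (trajectory K X).
Local Notation zeroT := (zero_trajectory K X).
Variables (dT : T -> T -> R) (p c : R) (r : nat) (kappa : nat -> nat -> R).
Hypotheses (hdT : is_distance dT) (hr : (0 < r)%N) (hp : 0 <= p) (hpc : p <= c).
Hypothesis hkappa : is_normalizer kappa.

Let D (a b : T) : R := cutoff dT c a b ^+ r.
Let q : R := p ^+ r.

Lemma cutoff_ge0 a b : 0 <= cutoff dT c a b.
Proof. by rewrite le_min (distance_ge0 hdT) (le_trans hp hpc). Qed.

Lemma cutoffC a b : cutoff dT c a b = cutoff dT c b a.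
Proof. by rewrite /cutoff (distance_sym hdT). Qed.

Lemma cutoff_diag a : cutoff dT c a a = 0.
Proof.
rewrite /cutoff; have /(distance_eq0 hdT) -> : a = a by [].
by rewrite min_l // (le_trans hp hpc).
Qed.

Let symD a b : D a b = D b a. Proof. by rewrite /D cutoffC. Qed.

Lemma matching_cost_ge0 x y : 0 <= matching_cost D q x y.
Proof.
rewrite addr_ge0 ?mulr_ge0 ?ler0n ?exprn_ge0 //.
by apply: sumr_ge0 => ab _; rewrite exprn_ge0 ?cutoff_ge0.
Qed.

Lemma matching_costE (x y : seq T) (pi : 'S_(size y)) : (size x <= size y)%N ->
  \sum_(l < size y | (l < size x)%N)
     cutoff dT c (nth zeroT x l) (nth zeroT y (pi l)) ^+ r
     + (size y - size x)%:R * p ^+ r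
  = matching_cost D q x [seq nth zeroT y (pi l) | l <- enum 'I_(size y)].
Proof.
move=> xy; set y' := map _ _.
have sy : size y' = size y by rewrite size_map size_enum_ord.
rewrite /matching_cost sy (eqP xy) add0n; congr (_ + _).
rewrite (big_nth (zeroT, zeroT)) big_mkord size_zip sy (minn_idPl xy).
rewrite (big_ord_widen _ (fun i => D (nth (zeroT, zeroT) (zip x y') i).1
                                   (nth (zeroT, zeroT) (zip x y') i).2) xy).
apply: eq_bigr => l lx; rewrite nth_zip_cond size_zip sy (minn_idPl xy) lx /=.
by rewrite (nth_map l) ?size_enum_ord // nth_ord_enum.
Qed.

Lemma root_expK (a : R) : 0 <= a -> (a `^ r%:R^-1) ^+ r = a.
Proof.
move=> a0; rewrite -powR_mulrn ?powR_ge0 // -powRrM mulVf ?powRr1 //.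
by rewrite pnatr_eq0 -lt0n.
Qed.

Lemma ospa_seq_exp (x y : seq T) : (size x <= size y)%N ->
  ospa_seq dT p c r kappa x y ^+ r
    = fmin [set: 'S_(size y)] (fun pi : 'S_(size y) =>
        (\sum_(l < size y | (l < size x)%N)
            cutoff dT c (nth zeroT x l) (nth zeroT y (pi l)) ^+ r
         + (size y - size x)%:R * p ^+ r) / kappa (size y) (size x)).
Proof.
move=> xy; rewrite root_expK //.
set F := (X in fmin _ X).
have [pi _ ->] := fmin_attained F (in_setT 1%g); rewrite /F.
by rewrite matching_costE // divr_ge0 ?matching_cost_ge0 // hkappa.1.
Qed.

Lemma ospa_seq_le (x y x' y' : seq T) : (size x <= size y)%N ->
  perm_eq x' x -> perm_eq y' y ->
  ospa_seq dT p c r kappa x y ^+ r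
    <= matching_cost D q x' y' / kappa (size x) (size y).
Proof.
move=> xy px py; have xy' : (size x <= size y')%N by rewrite (perm_size py).
have [z pz <-] := matching_cost_perm D q px xy'.
have /tuple_permP[pi zE] : perm_eq z (in_tuple y) by exact: perm_trans py.
have {}zE : z = [seq nth zeroT y (pi l) | l <- enum 'I_(size y)].
  by rewrite zE /=; apply: eq_map => l; rewrite (tnth_nth zeroT).
rewrite ospa_seq_exp // zE -matching_costE // (hkappa.2 (size x)).
exact: fmin_le (in_setT pi).
Qed.

Lemma ospa_seq_attained (x y : seq T) : (size x <= size y)%N ->
  exists2 y', perm_eq y' y &
    ospa_seq dT p c r kappa x y ^+ r
      = matching_cost D q x y' / kappa (size x) (size y).
Proof.
move=> xy; rewrite ospa_seq_exp //.
set F := (X in fmin _ X).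
have [pi _ ->] := fmin_attained F (in_setT 1%g); rewrite /F.
exists [seq nth zeroT y (pi l) | l <- enum 'I_(size y)].
  apply/(@tuple_permP _ _ _ (in_tuple y)); exists pi => /=.
  by apply: eq_map => l; rewrite (tnth_nth zeroT).
by rewrite matching_costE // (hkappa.2 (size y)).
Qed.

Lemma ospa_le (x y : {mset T}) (x' y' : seq T) :
  perm_eq x' x -> perm_eq y' y ->
  ospa dT p c r kappa x y ^+ r
    <= matching_cost D q x' y' / kappa (size x) (size y).
Proof.
move=> px py; rewrite /ospa; case: ifP => [_|_].
  (* Both are empty and the distance is 0 by convention, so nonnegativity of the right-hand side
     suffices. *)
  by rewrite expr0n eqn0Ngt hr divr_ge0 ?matching_cost_ge0 // hkappa.1.
case: leqP => [xy|/ltnW yx]; first exact: ospa_seq_le.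
by rewrite hkappa.2 matching_costC //; exact: ospa_seq_le.
Qed.

Lemma ospa_attained (x y : {mset T}) : exists x' y' : seq T,
  [/\ perm_eq x' x, perm_eq y' y &
   ospa dT p c r kappa x y ^+ r
     = matching_cost D q x' y' / kappa (size x) (size y)].
Proof.
rewrite /ospa; case: ifP => [/andP[/nilP x0 /nilP y0]|_].
  (* The convention agrees with the formula here: the matching cost is 0, and so is its quotient,
     whatever [kappa 0 0] is. *)
  exists x, y; split=> //; rewrite x0 y0 matching_cost_nil mul0r mul0r.
  by rewrite expr0n eqn0Ngt hr.
case: leqP => [xy|/ltnW yx].
  by have [y' py E] := ospa_seq_attained xy; exists x, y'.
have [x' px E] := ospa_seq_attained yx; exists x', y; split=> //.
by rewrite E hkappa.2 matching_costC.
Qed.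

(** * Existence and trajectory lists, and the minimum of the cost over assignments *)

Section Lists.
Variable L : nat.
Implicit Types (eta : {ffun 'I_L -> bool}) (tau : {ffun 'I_L -> T}).

Definition slots eta tau (l : 'I_L) : option T :=
  if eta l then Some (tau l) else None.

Lemma pmap_slots eta tau :
  pmap (slots eta tau) (enum 'I_L) = [seq tau l | l <- enum 'I_L & eta l].
Proof. by elim: (enum _) => //= l s IH; rewrite /slots; case: (eta l); rewrite /= -IH. Qed.

Lemma slots_some eta tau l : isSome (slots eta tau l) = eta l.
Proof. by rewrite /slots; case: (eta l). Qed.

Lemma perm_of_lists eta tau :
  perm_eq (of_lists eta tau) (pmap (slots eta tau) (enum 'I_L)).
Proof. by rewrite pmap_slots; exact: perm_eq_seq_mset. Qed.

Lemma size_of_lists eta tau : size (of_lists eta tau) = Defs.norm1 eta.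
Proof.
rewrite (perm_size (perm_of_lists _ _)) size_pmap /Defs.norm1.
by rewrite -sum1_count big_enum_cond -big_mkcond /=; apply: eq_bigl => l; rewrite slots_some.
Qed.

Lemma of_listsK (s : seq T) : (size s <= L)%N ->
  of_lists (existence_list L s) (trajectory_list L s) = seq_mset s.
Proof.
move=> sL; rewrite /of_lists -pmap_slots -[in RHS](pmap_onth sL); congr seq_mset.
apply: eq_pmap => l; rewrite /slots !ffunE; case: ltnP => ls.
  by rewrite onthE (nth_map zeroT).
by rewrite onthE nth_default ?size_map.
Qed.

Variables (N : nat) (xi : 'I_N -> {ffun 'I_L -> bool}) (chi : 'I_N -> {ffun 'I_L -> T}).

(** The values of [eta l] and [xi n (omega n l)] select the four branches of [slot_cost]. With the
    sum over [n] outside, each component of [omega] affects a single term. *)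
Lemma Qcost_slots (omega : {ffun 'I_N -> 'S_L}) eta tau :
  Qcost dT p c r kappa xi chi omega eta tau
    = \sum_(n < N)
        (\sum_(l < L) slot_cost D q (slots eta tau l) (slots (xi n) (chi n) (omega n l)))
        / kappa (Defs.norm1 eta) (Defs.norm1 (xi n)).
Proof.
transitivity (\sum_(l < L) \sum_(n < N)
  slot_cost D q (slots eta tau l) (slots (xi n) (chi n) (omega n l))
    / kappa (Defs.norm1 eta) (Defs.norm1 (xi n))); last first.
  by rewrite exchange_big; apply: eq_bigr => n _; rewrite mulr_suml.
apply: eq_bigr => l _; rewrite /phi /phibar !mulr_sumr -big_split.
apply: eq_bigr => n _; rewrite /slots /D /q.
by case: (eta l); case: (xi n _);
  rewrite /= ?subrr ?subr0 ?mul1r ?mul0r ?addr0 ?add0r ?mul0r.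
Qed.

Lemma min_Qcost_ospa eta tau :
  min_Qcost dT p c r kappa xi chi eta tau
    = \sum_(n < N) ospa dT p c r kappa (of_lists eta tau) (of_lists (xi n) (chi n)) ^+ r.
Proof.
have [omega omegaP] : exists omega : {ffun 'I_N -> 'S_L}, forall n,
    omega n \in assignments eta (xi n) /\
    (\sum_(l < L) slot_cost D q (slots eta tau l) (slots (xi n) (chi n) (omega n l)))
        / kappa (Defs.norm1 eta) (Defs.norm1 (xi n))
    = ospa dT p c r kappa (of_lists eta tau) (of_lists (xi n) (chi n)) ^+ r.
  (* The admissible set is a product over [n], so optimal assignments can be chosen separately for
     each [n]. *)
  suff /fin_all_exists[w wP] : forall n, exists pi : 'S_L,
      pi \in assignments eta (xi n) /\
      (\sum_(l < L) slot_cost D q (slots eta tau l) (slots (xi n) (chi n) (pi l)))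
        / kappa (Defs.norm1 eta) (Defs.norm1 (xi n))
      = ospa dT p c r kappa (of_lists eta tau) (of_lists (xi n) (chi n)) ^+ r.
    by exists [ffun n => w n] => n; rewrite ffunE.
  move=> n; have [x [y [px py ->]]] := ospa_attained (of_lists eta tau) (of_lists (xi n) (chi n)).
  have [pi [le_xy le_yx] E] :=
    exists_slot_perm q symD (perm_trans px (perm_of_lists _ _)) (perm_trans py (perm_of_lists _ _)).
  exists pi; rewrite E !size_of_lists; split=> //; rewrite inE.
  rewrite (perm_size px) (perm_size py) !size_of_lists in le_xy le_yx.
  case: leqP => [/le_xy|/ltnW/le_yx] imp; apply/forallP => l; apply/implyP;
    by have := imp l; rewrite !slots_some.
have omega_adm : omega \in all_assignments xi eta.
  by rewrite inE; apply/forallP => n; have [] := omegaP n.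
apply/le_anti/andP; split.
  rewrite (le_trans (fmin_le _ omega_adm)) // Qcost_slots.
  by apply: ler_sum => n _; have [_ ->] := omegaP n.
rewrite /min_Qcost.
have [w w_adm ->] := fmin_attained
  (fun w => Qcost dT p c r kappa xi chi w eta tau) omega_adm.
rewrite Qcost_slots; apply: ler_sum => n _.
have /forallP/(_ n) : [forall n, w n \in assignments eta (xi n)] by move: w_adm; rewrite inE.
rewrite inE => adm.
(* Admissibility gives the inclusion of occupied slots, in the direction decided by the
   cardinalities. The resulting matching bounds the distance from above. *)
have [|x [y [px py ->]]] := slots_matching q symD (a := slots eta tau)
    (b := fun l => slots (xi n) (chi n) (w n l)).
  by case: leqP adm => _ /forallP adm; [left | right] => l; rewrite !slots_some; apply/implyP.
rewrite -(size_of_lists eta tau) -(size_of_lists (xi n) (chi n)); apply: ospa_le.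
  by rewrite (perm_trans px) // perm_sym perm_of_lists.
rewrite (perm_trans py) // perm_sym (perm_trans (perm_of_lists _ _)) //.
(* Reindexing the slots by [w n] only changes the order in which the objects are listed. *)
rewrite -(pmap_id_map (fun l => slots _ _ (w n l))) (map_comp (slots _ _) (w n)) pmap_id_map.
apply: perm_pmap; rewrite perm_sym; have -> : enum 'I_L = ord_tuple L by [].
by apply/tuple_permP; exists (w n); apply: eq_map => l; rewrite tnth_ord_tuple.
Qed.
End Lists.

(** Matching [y] with itself is free, since the cut-off distance vanishes on the diagonal; only the
    elements of [z] pay. *)
Lemma ospa_superset (x y z : seq T) : perm_eq x (y ++ z) ->
  ospa dT p c r kappa (seq_mset x) (seq_mset y) ^+ r
    <= ((size x - size y)%:R / kappa (size x) (size y)) * p ^+ r.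
Proof.
move=> pxyz.
have px := perm_eq_seq_mset x; have py := perm_eq_seq_mset y.
rewrite -(perm_size px) -(perm_size py).
apply: le_trans (ospa_le (x' := y ++ z) (y' := y) _ _) _; rewrite 1?perm_sym //.
  by rewrite (perm_trans px).
rewrite mulrAC ler_wpM2r ?invr_ge0 ?hkappa.1 //.
rewrite (perm_size px) (perm_size pxyz) (perm_size py) -/q size_cat addKn.
rewrite le_eqVlt; apply/orP; left; apply/eqP.
elim: {px py pxyz} y => [|a y IH]; first by rewrite matching_costC // matching_cost_nil.
by rewrite cat_cons matching_cost_cons IH /D cutoff_diag expr0n eqn0Ngt hr add0r.
Qed.

Lemma ospa_large (x y : {mset T}) : (size y <= size x)%N ->
  ((size x - size y)%:R / kappa (size x) (size y)) * p ^+ r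
    <= ospa dT p c r kappa x y ^+ r.
Proof.
move=> yx; have [x' [y' [px py ->]]] := ospa_attained x y.
rewrite mulrAC ler_wpM2r ?invr_ge0 ?hkappa.1 // -/q /matching_cost.
rewrite (perm_size px) (perm_size py) (eqP yx) addn0 lerDr.
by apply: sumr_ge0 => ab _; rewrite exprn_ge0 ?cutoff_ge0.
Qed.
End Ospa.

Theorem proposition5 (R : realType) (K : finType) (X : zmodType)
  (dT : trajectory K X -> trajectory K X -> R) (hdT : is_distance dT)
  (r : nat) (hr : (0 < r)%N)
  (p c : R) (hp : 0 <= p) (hpc : p <= c) (hc : c <= 2 `^ r%:R^-1 * p)
  (kappa : nat -> nat -> R) (hkappa : is_normalizer kappa)
  (hmono : monotone_cardinality_penalty kappa)
  (N : nat) (Y : 'I_N -> {mset trajectory K X})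
  (L : nat) (hL : L = (\sum_(n < N) size (Y n))%N)
  (s : 'I_N -> seq (trajectory K X)) (hs : forall n, seq_mset (s n) = Y n)
  (xi : 'I_N -> {ffun 'I_L -> bool}) (hxi : forall n, xi n = existence_list L (s n))
  (chi : 'I_N -> {ffun 'I_L -> trajectory K X})
  (hchi : forall n, chi n = trajectory_list L (s n))
  (etahat : {ffun 'I_L -> bool}) (tauhat : {ffun 'I_L -> trajectory K X})
  (hmin : forall (eta : {ffun 'I_L -> bool}) (tau : {ffun 'I_L -> trajectory K X}),
     min_Qcost dT p c r kappa xi chi etahat tauhat
       <= min_Qcost dT p c r kappa xi chi eta tau) :
  frechet_mean dT p c r kappa Y (of_lists etahat tauhat).
Proof.
have size_s n : size (s n) = size (Y n).
  by rewrite -hs (perm_size (perm_eq_seq_mset _)).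
have sL n : (size (s n) <= L)%N by rewrite hL (bigD1 n) //= size_s leq_addr.
have YE n : Y n = of_lists (xi n) (chi n) by rewrite hxi hchi of_listsK.
have opt (w : seq (trajectory K X)) : (size w <= L)%N ->
    \sum_(n < N) ospa dT p c r kappa (of_lists etahat tauhat) (Y n) ^+ r
      <= \sum_(n < N) ospa dT p c r kappa (seq_mset w) (Y n) ^+ r.
  move=> wL; have := hmin (existence_list L w) (trajectory_list L w).
  rewrite !min_Qcost_ospa // of_listsK //.
  by congr (_ <= _); apply: eq_bigr => n _; rewrite YE.
move=> z; have zE : seq_mset z = z by exact: seq_mset_id.
case: (leqP (size z) L) => [zL | /ltnW Lz].
  by rewrite -[X in _ <= \sum_(n < N) ospa _ _ _ _ _ X _ ^+ _]zE; exact: opt.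
pose u := flatten [seq s n | n <- enum 'I_N].
have uL : size u = L.
  rewrite size_flatten sumnE big_map big_map big_enum hL.
  by apply: eq_bigr => n _; rewrite size_s.
apply: le_trans (opt u _) _; rewrite ?uL //; apply: ler_sum => n _.
(* Moving the block [s n] to the front exhibits [u] as [s n] plus unmatched elements, as
   [ospa_superset] requires. *)
have pu : perm_eq u (s n ++ flatten [seq s m | m <- rem n (enum 'I_N)]).
  rewrite -[X in perm_eq _ X]/(flatten [seq s m | m <- n :: rem n (enum 'I_N)]).
  by apply/perm_flatten/perm_map/perm_to_rem; rewrite mem_enum.
rewrite -hs (le_trans (ospa_superset hdT hr hp hpc hkappa pu)) // uL.
apply: le_trans (ospa_large hdT hr hp hpc hkappa _); rewrite hs -size_s ?(leq_trans (sL n)) //.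
(* The penalty is compared along [size (Y n) <= L <= size z]. *)
by rewrite ler_wpM2r ?exprn_ge0 //; exact: hmono.
Qed.
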